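(* (1) For every $\omega\in\{0,1\}^\infty$, the map $\varphi:V(\Gamma_\omega)\to V_\omega=\mathbb{Z}$ defined by the rule $$\varphi(a^m(\omega))=m\quad\text{for } m\in\mathbb{Z}$$ is a graph isomorphism from the orbital Schreier graph $\Gamma_\omega$ to $X_\omega$. (2) For every $n\ge1$, the map $\varphi_n:V(\Gamma_n)\to V_n=\{0,1,\ldots,2^n-1\}$ defined by the rule $$\varphi_n(a^m(0^n))=m\quad\text{for } m=0,1,\ldots,2^n-1$$ is a graph isomorphism from the Schreier graph $\Gamma_n$ to $X_n$.
   Context: $\{0,1\}^{\infty}$ is the set of infinite sequences $x_1x_2\ldots$ with $x_i\in\{0,1\}$. The group $G$. $G$ is the group generated by the two bijections $a,b$ of $\{0,1\}^\infty$ defined recursively by $a(0w)=1w$, $a(1w)=0\,a(w)$, $b(0w)=0\,b(w)$, $b(1w)=1\,a(w)$ for all $w\in\{0,1\}^\infty$. The same rules (with the empty word fixed) define the action of $G$ on the set $\{0,1\}^n$ of words of length $n$, for each $n\ge 1$. Schreier graphs. $\Gamma_n$ is the graph with vertex set $\{0,1\}^n$ and one edge between $v$ and $s(v)$ for each $v\in\{0,1\}^n$ and $s\in\{a,b\}$. For $\omega\in\{0,1\}^\infty$, $\Gamma_\omega$ is the graph whose vertex set is the orbit $G(\omega)$, with one edge between $v$ and $s(v)$ for each $v\in G(\omega)$ and $s\in\{a,b\}$. Isomorphisms ignore edge labels and orientations. Loops and multiple edges are allowed. Definition of $X_\omega$. For $\omega=x_1x_2\ldots\in\{0,1\}^\infty$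 and $n\ge 1$ put $a_n^{\omega}=\sum_{i=1}^n x_i2^{i-1}-2^{n-1}$. The graph $X_\omega$ is undirected with vertex set $V_\omega=\mathbb{Z}$. Its edges are those of the disjoint union $\coprod_{n\ge 0}E^n_\omega$, where $E^0_\omega=\{(z,z+1):z\in\mathbb{Z}\}$ and, for $n\ge1$, $E^n_\omega=\{(2^nz-a_n^\omega,\,2^n(z+1)-a_n^\omega):z\in\mathbb{Z}\}$; in addition, if there is a vertex not incident to any edge of $\coprod_{n\ge 1}E^n_\omega$ (there is at most one such vertex), a loop is added at that vertex. Definition of $X_n$. For $n\ge1$, $X_n$ is the undirected graph with vertex set $V_n=\mathbb{Z}/2^n\mathbb{Z}=\{0,1,\ldots,2^n-1\}$ and edges $(z \bmod 2^n,\ z+1\bmod 2^n)$ and $(2^kz+2^{k-1}\bmod 2^n,\ 2^k(z+1)+2^{k-1}\bmod 2^n)$ for $z\in\mathbb{Z}$, $k\ge1$. Each residue is the starting point (first coordinate) of exactly one edge of the first kind and exactly one edge of the second kind, edges being counted once per starting residue and kind; thus $X_n$ is $4$-regular, with loops at $0$ and $2^{n-1}$. *)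

(* Defs.v *)
From HB Require Import structures.
From mathcomp Require Import all_boot all_order all_algebra.
From Stdlib Require Import FunctionalExtensionality.

Set Implicit Arguments.
Unset Strict Implicit.
Unset Printing Implicit Defensive.

Import Order.TTheory GRing.Theory Num.Theory.
Local Open Scope ring_scope.

(** Undirected multigraphs: [ends e] lists the two endpoints of [e] in an
    arbitrary order, which isomorphisms are free to exchange. *)

Record mgraph := MGraph {
  vertex : Type;
  edge : Type;
  ends : edge -> vertex * vertex
}.

Definition same_ends (V : Type) (p q : V * V) : Prop :=
  p = q \/ p = (q.2, q.1).

(* As multiple edges are allowed, a vertex map is an isomorphism when it is
   bijective and is accompanied by a bijection of the edges respecting
   endpoints, i.e. when it preserves edge multiplicities. *)
Definition graph_iso (X Y : mgraph) (f : vertex X -> vertex Y) : Prop :=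
  bijective f /\
  exists2 g : edge X -> edge Y, bijective g &
    forall e : edge X,
      same_ends (ends (g e)) (f (ends e).1, f (ends e).2).

Arguments graph_iso X Y f : clear implicits.

(** The letter x_i of x_1 x_2 ... is the value at index [i.-1]; [true] is 1. *)

Definition stream := nat -> bool.

Definition scons (x : bool) (w : stream) : stream :=
  fun i => if i is j.+1 then w j else x.

Definition stail (w : stream) : stream := fun i => w i.+1.

(* Recursion on the index; the equations between streams are proved below. *)
Fixpoint a_stream (w : stream) (i : nat) : bool :=
  match i with
  | 0 => ~~ w 0%N
  | j.+1 => if w 0%N then a_stream (stail w) j else w i
  end.

Fixpoint b_stream (w : stream) (i : nat) : bool :=
  match i with
  | 0 => w 0%N
  | j.+1 => if w 0%N then a_stream (stail w) j else b_stream (stail w) j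
  end.

Fixpoint a_word (w : seq bool) : seq bool :=
  match w with
  | [::] => [::]
  | false :: w' => true :: w'
  | true :: w' => false :: a_word w'
  end.

Fixpoint b_word (w : seq bool) : seq bool :=
  match w with
  | [::] => [::]
  | false :: w' => false :: b_word w'
  | true :: w' => true :: a_word w'
  end.

Lemma a_stream0 (w : stream) : a_stream (scons false w) = scons true w.
Proof. by apply: functional_extensionality; case. Qed.

Lemma a_stream1 (w : stream) :
  a_stream (scons true w) = scons false (a_stream w).
Proof. by apply: functional_extensionality; case. Qed.

Lemma b_stream0 (w : stream) :
  b_stream (scons false w) = scons false (b_stream w).
Proof. by apply: functional_extensionality; case. Qed.

Lemma b_stream1 (w : stream) :
  b_stream (scons true w) = scons true (a_stream w).
Proof. by apply: functional_extensionality; case. Qed.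

Fixpoint a_inv (w : stream) (i : nat) : bool :=
  match i with
  | 0 => ~~ w 0%N
  | j.+1 => if w 0%N then w i else a_inv (stail w) j
  end.

Fixpoint b_inv (w : stream) (i : nat) : bool :=
  match i with
  | 0 => w 0%N
  | j.+1 => if w 0%N then a_inv (stail w) j else b_inv (stail w) j
  end.

Lemma a_streamK : cancel a_stream a_inv.
Proof.
move=> w; apply: functional_extensionality => i.
elim: i w => [|i IHi] w /=; first by rewrite negbK.
by case: (boolP (w 0%N)) => w0 //=; rewrite -[RHS](IHi (stail w));
  congr (a_inv _ i); apply: functional_extensionality => j;
  rewrite /stail /= w0.
Qed.

Lemma a_invK : cancel a_inv a_stream.
Proof.
move=> w; apply: functional_extensionality => i.
elim: i w => [|i IHi] w /=; first by rewrite negbK.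
by case: (boolP (w 0%N)) => w0 //=; rewrite -[RHS](IHi (stail w));
  congr (a_stream _ i); apply: functional_extensionality => j;
  rewrite /stail /= (negbTE w0).
Qed.

Lemma b_streamK : cancel b_stream b_inv.
Proof.
move=> w; apply: functional_extensionality => i.
elim: i w => [|i IHi] w //=.
have Et : stail (b_stream w) =
    if w 0%N then a_stream (stail w) else b_stream (stail w).
  by apply: functional_extensionality => j; rewrite /stail /=; case: (w 0%N).
rewrite Et; case: (w 0%N); first by rewrite a_streamK.
by rewrite IHi.
Qed.

Lemma b_invK : cancel b_inv b_stream.
Proof.
move=> w; apply: functional_extensionality => i.
elim: i w => [|i IHi] w //=.
have Et : stail (b_inv w) =
    if w 0%N then a_inv (stail w) else b_inv (stail w).
  by apply: functional_extensionality => j; rewrite /stail /=; case: (w 0%N).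
rewrite Et; case: (w 0%N); first by rewrite a_invK.
by rewrite IHi.
Qed.

Lemma size_a_word (w : seq bool) : size (a_word w) = size w.
Proof. by elim: w => [|[] w IHw] //=; rewrite IHw. Qed.

Lemma size_b_word (w : seq bool) : size (b_word w) = size w.
Proof. by elim: w => [|[] w IHw] //=; rewrite ?IHw ?size_a_word. Qed.

Inductive gen := gen_a | gen_b.

Definition act_stream (s : gen) : stream -> stream :=
  match s with gen_a => a_stream | gen_b => b_stream end.

Definition act_word (s : gen) : seq bool -> seq bool :=
  match s with gen_a => a_word | gen_b => b_word end.

Lemma act_tuple_proof (n : nat) (s : gen) (t : n.-tuple bool) :
  size (act_word s t) == n.
Proof. by case: s; rewrite /= (size_a_word, size_b_word) size_tuple. Qed.

Definition act_tuple (n : nat) (s : gen) (t : n.-tuple bool) : n.-tuple bool :=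
  Tuple (act_tuple_proof s t).

Definition a_pow (m : int) : stream -> stream :=
  match m with
  | Posz k => iter k a_stream
  | Negz k => iter k.+1 a_inv
  end.

(* The group G generated by a and b, as a set of transformations. *)
Inductive in_G : (stream -> stream) -> Prop :=
| in_G_gen s : in_G (act_stream s)
| in_G_id : in_G id
| in_G_comp g h : in_G g -> in_G h -> in_G (g \o h)
| in_G_inv g h : in_G g -> cancel g h -> cancel h g -> in_G h.

Definition in_orbit (w v : stream) : Prop := exists2 g, in_G g & v = g w.

Definition orbit_of (w : stream) : Type := {v : stream | in_orbit w v}.

Lemma act_orbit_proof (w : stream) (s : gen) (v : orbit_of w) :
  in_orbit w (act_stream s (sval v)).
Proof.
case: v => v [g Gg Ev] /=; rewrite Ev.
by exists (act_stream s \o g) => //; apply: in_G_comp => //; apply: in_G_gen.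
Qed.

Definition act_orbit (w : stream) (s : gen) (v : orbit_of w) : orbit_of w :=
  exist _ (act_stream s (sval v)) (act_orbit_proof s v).

Definition Gamma_orbit (w : stream) : mgraph :=
  {| vertex := orbit_of w;
     edge := orbit_of w * gen;
     ends := fun e => (e.1, act_orbit e.2 e.1) |}.

Definition Gamma_fin (n : nat) : mgraph :=
  {| vertex := n.-tuple bool;
     edge := n.-tuple bool * gen;
     ends := fun e => (e.1, act_tuple e.2 e.1) |}.

Definition a_coef (w : stream) (n : nat) : int :=
  (\sum_(0 <= i < n) (w i)%:Z * 2 ^+ i) - 2 ^+ n.-1.

Definition E_orbit (w : stream) (n : nat) (e : int * int) : Prop :=
  if n is 0 then exists z : int, e = (z, z + 1)
  else exists z : int,
    e = (2 ^+ n * z - a_coef w n, 2 ^+ n * (z + 1) - a_coef w n).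

(* Not incident to any edge at a positive level (level 0 touches every vertex). *)
Definition isolated (w : stream) (v : int) : Prop :=
  forall (n : nat) (e : int * int),
    (1 <= n)%N -> E_orbit w n e -> v <> e.1 /\ v <> e.2.

Definition X_orbit (w : stream) : mgraph :=
  {| vertex := int;
     edge := {n : nat & {e : int * int | E_orbit w n e}}
             + {v : int | isolated w v};
     ends := fun e =>
       match e with
       | inl c => sval (tagged c)
       | inr v => (sval v, sval v)
       end |}.

(* ['Z_(2 ^ n)] is Z/2^n only for n >= 1. *)

(* The starting residue determines the edge of each kind, so counting edges
   once per kind and starting residue means taking sets of ordered pairs. *)
Definition E_fin1 (n : nat) (e : 'Z_(2 ^ n) * 'Z_(2 ^ n)) : Prop :=
  exists z : int, e = (z%:~R, (z + 1)%:~R).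

Definition E_fin2 (n : nat) (e : 'Z_(2 ^ n) * 'Z_(2 ^ n)) : Prop :=
  exists (z : int) (k : nat), (1 <= k)%N /\
    e = ((2 ^+ k * z + 2 ^+ k.-1)%:~R, (2 ^+ k * (z + 1) + 2 ^+ k.-1)%:~R).

Definition X_fin (n : nat) : mgraph :=
  {| vertex := 'Z_(2 ^ n);
     edge := {e : 'Z_(2 ^ n) * 'Z_(2 ^ n) | E_fin1 e}
             + {e : 'Z_(2 ^ n) * 'Z_(2 ^ n) | E_fin2 e};
     ends := fun e => match e with inl c => sval c | inr c => sval c end |}.

Definition rule_orbit (w : stream)
    (phi : vertex (Gamma_orbit w) -> vertex (X_orbit w)) : Prop :=
  forall (m : int) (v : orbit_of w), sval v = a_pow m w -> phi v = m.

Definition rule_fin (n : nat)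
    (phi : vertex (Gamma_fin n) -> vertex (X_fin n)) : Prop :=
  forall m : nat, (m < 2 ^ n)%N ->
    phi (iter m (act_tuple gen_a) (nseq_tuple n false)) = m :> nat.

Arguments rule_orbit w phi : clear implicits.
Arguments rule_fin n phi : clear implicits.

(* Main.v *)
(** Reading the first n letters of a word as the binary digits of a number,
    least significant first, turns a into addition of 1 modulo 2^n (the adding
    machine).  If k is the position of the first letter 1, then b changes only
    the part after it, where it acts as a, so b adds 2^(k+1); and b fixes the
    zero word.  Hence the orbit of omega is its a-orbit, on which a acts freely,
    and in the coordinate m of a^m(omega) the b-edge at m has length 2^(k+1)
    exactly when m + x_1 + 2 x_2 + ... + 2^k x_(k+1) = 2^k modulo 2^(k+1), i.e.
    when m is congruent to -a_(k+1).  These are the edges of X_omega, the loop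
    sitting at the m with a^m(omega) = 000..., if any.  Edges of the two graphs
    are matched through the map from the X-side, sending an edge to its starting
    vertex together with the generator. *)

Require Import Defs.
From HB Require Import structures.
From mathcomp Require Import all_boot all_order all_algebra.
From Stdlib Require Import FunctionalExtensionality ClassicalEpsilon.
From mathcomp Require Import zify ring.

Set Implicit Arguments.
Unset Strict Implicit.
Unset Printing Implicit Defensive.

Import Order.TTheory GRing.Theory Num.Theory.

(** * Bijections, subtypes and isomorphisms of multigraphs *)

Lemma inj_surj_bij (A B : Type) (f : A -> B) :
  injective f -> (forall y, exists x, f x = y) -> bijective f.
Proof.
move=> f_inj f_surj.
pose g y := sval (constructive_indefinite_description _ (f_surj y)).
have fg : cancel g f.
  by move=> y; rewrite /g; case: constructive_indefinite_description.
by exists g => // x; apply: f_inj; rewrite fg.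
Qed.

Lemma sig_inj (A : Type) (P : A -> Prop) : injective (@sval A P).
Proof.
move=> [x Px] [y Py] /= Exy; subst y; congr exist; exact: proof_irrelevance.
Qed.

(** Mapping the edges of [Y] to those of [X] lets the edge map be defined without choosing
    membership proofs; the endpoints then match in order, with no exchange. *)
Lemma graph_iso_inv (X Y : mgraph) (f : vertex X -> vertex Y)
    (h : edge Y -> edge X) :
  bijective f -> bijective h ->
  (forall e, ends e = (f (ends (h e)).1, f (ends (h e)).2)) ->
  graph_iso X Y f.
Proof.
move=> f_bij [g hK gK] h_ends; split=> //; exists g; first by exists h.
by move=> e; left; rewrite h_ends gK.
Qed.

Lemma all_false_or_first (w : stream) :
  (forall i, w i = false) \/
  (exists n, w n /\ forall i, i < n -> w i = false).
Proof.
case: (classic (exists i, w i)) => [w1|w0]; [right | left=> i].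
  case: (ex_minnP w1) => n wn n_min; exists n; split=> // i lt_in.
  by apply: contraTF lt_in => /n_min; rewrite -leqNgt.
by apply/negbTE/negP=> wi; apply: w0; exists i.
Qed.

(** * Binary values of finite words and of prefixes of streams *)

Fixpoint bval (s : seq bool) : nat :=
  if s is x :: s' then x + 2 * bval s' else 0.

Lemma bval_lt (s : seq bool) : bval s < 2 ^ size s.
Proof. by elim: s => [|[] s IHs] //=; rewrite expnS; lia. Qed.

Lemma bval_inj (s t : seq bool) : size s = size t -> bval s = bval t -> s = t.
Proof.
elim: s t => [|x s IHs] [|y t] //= [Est] E.
have Exy : x = y by case: x y E => [] []; lia.
by rewrite Exy (IHs t) // ; move: E; rewrite Exy; lia.
Qed.

Lemma bval_inj_mod (s t : seq bool) :
  size s = size t -> bval s = bval t %[mod 2 ^ size s] -> s = t.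
Proof.
move=> Est; rewrite (modn_small (bval_lt s)) Est (modn_small (bval_lt t)).
exact: bval_inj.
Qed.

Lemma bval_nseq0 (n : nat) : bval (nseq n false) = 0.
Proof. by elim: n => //= n ->. Qed.

Lemma bval_rcons (s : seq bool) (x : bool) :
  bval (rcons s x) = bval s + 2 ^ size s * x.
Proof. by elim: s => [|y s IHs] /=; rewrite ?IHs ?expnS; lia. Qed.

(** The modulus absorbs the carry out of the last letter: a sends 1...1 to 0...0. *)
Lemma bval_a_word (s : seq bool) :
  bval (a_word s) = (bval s).+1 %[mod 2 ^ size s].
Proof.
elim: s => [|[] s IHs] //=.
rewrite add0n expnS -muln_modr IHs muln_modr; congr (_ %% _); lia.
Qed.

(* The minimum lets k >= size s stand for the zero word, which b fixes. *)
Lemma bval_b_word (s : seq bool) (k : nat) :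
  bval s = 2 ^ k %[mod 2 ^ minn k.+1 (size s)] ->
  bval (b_word s) = bval s + 2 ^ k.+1 %[mod 2 ^ size s].
Proof.
elim: s k => [|[] s IHs] [|k] /=; rewrite ?expn0 ?modn1 // minnSS.
- move=> _; have E : 1 + 2 * bval s + 2 ^ 1 = 1 + 2 * (bval s).+1 by lia.
  by rewrite E expnS -[LHS]modnDmr -[RHS]modnDmr -!muln_modr bval_a_word.
(* A leading 1 makes the value odd, while [2 ^ k.+1] and the modulus are even: contradiction. *)
- rewrite !expnS !mul2n => /(congr1 odd).
  by rewrite !odd_mod ?odd_double //= odd_double.
- by rewrite min0n expn1 add0n modnMr.
rewrite !add0n (expnS 2 k.+1) (expnS 2 (size s)) (expnS 2 (minn _ _)) => E.
rewrite -mulnDr -!muln_modr; congr (_ * _); apply: IHs.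
by move: E; rewrite expnS -!muln_modr; lia.
Qed.

Lemma mkseq_cons (w : stream) (n : nat) :
  mkseq w n.+1 = w 0 :: mkseq (stail w) n.
Proof. by rewrite /mkseq /= -[1]addn0 iotaDl -map_comp. Qed.

Lemma mkseq_a (w : stream) (n : nat) :
  mkseq (a_stream w) n = a_word (mkseq w n).
Proof.
elim: n w => // n IHn w; rewrite !mkseq_cons /=.
have -> : stail (a_stream w) = if w 0 then a_stream (stail w) else stail w.
  by apply: functional_extensionality => j; rewrite /stail /=; case: (w 0).
by case: (w 0); rewrite /= ?IHn.
Qed.

Lemma mkseq_b (w : stream) (n : nat) :
  mkseq (b_stream w) n = b_word (mkseq w n).
Proof.
elim: n w => // n IHn w; rewrite !mkseq_cons /=.
have -> : stail (b_stream w) =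
    if w 0 then a_stream (stail w) else b_stream (stail w).
  by apply: functional_extensionality => j; rewrite /stail /=; case: (w 0).
by case: (w 0); rewrite /= ?mkseq_a ?IHn.
Qed.

(** This is the hypothesis of [bval_b_word]. If [n <= k], the prefix is zero and [2 ^ k] vanishes
    modulo [2 ^ n]. *)
Lemma bval_mkseq_mod (w : stream) (k n : nat) :
  w k -> (forall i, i < k -> w i = false) ->
  bval (mkseq w n) = 2 ^ k %[mod 2 ^ minn k.+1 n].
Proof.
elim: k w n => [|k IHk] w [|n] wk w0; rewrite ?minn0 ?expn0 ?modn1 //.
  by rewrite mkseq_cons wk minnSS min0n /=; lia.
rewrite mkseq_cons w0 //= minnSS add0n !expnS -!muln_modr IHk ?expnS //.
by move=> i lt_ik; apply: w0.
Qed.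

(** The word 0...01 of length [n.+1] has value [2 ^ n], and values are injective at fixed length. *)
Lemma bval_mkseq_first (w : stream) (n : nat) :
  bval (mkseq w n.+1) = 2 ^ n <-> w n /\ forall i, i < n -> w i = false.
Proof.
have E1 : bval (rcons (nseq n false) true) = 2 ^ n.
  by rewrite bval_rcons bval_nseq0 size_nseq muln1.
have nth1 i : i < n -> nth false (mkseq w n.+1) i = w i.
  by move=> lt_in; rewrite nth_mkseq // ltnS ltnW.
split=> [|[wn w0]].
  rewrite -E1 => /bval_inj; rewrite size_mkseq size_rcons size_nseq.
  move=> /(_ erefl) E.
  split=> [|i lt_in]; last
    by rewrite -nth1 // E nth_rcons size_nseq lt_in nth_nseq lt_in.
  by rewrite -(nth_mkseq false w (ltnSn n)) E nth_rcons size_nseq ltnn eqxx.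
rewrite -E1; congr bval; apply: (@eq_from_nth _ false).
  by rewrite size_mkseq size_rcons size_nseq.
rewrite size_mkseq => i; rewrite ltnS leq_eqVlt => /predU1P[->|lt_in].
  by rewrite nth_mkseq // wn nth_rcons size_nseq ltnn eqxx.
by rewrite nth1 // w0 // nth_rcons size_nseq lt_in nth_nseq lt_in.
Qed.

Local Open Scope ring_scope.

(** * Streams as 2-adic integers *)

Definition pval (w : stream) (n : nat) : int := (bval (mkseq w n))%:Z.

Lemma Posz_exp2 (n : nat) : (2 ^ n)%N%:Z = 2 ^+ n.
Proof. by rewrite -natz natrX. Qed.

Lemma pvalE (w : stream) (n : nat) :
  pval w n = \sum_(0 <= i < n) (w i)%:Z * 2 ^+ i.
Proof.
rewrite /pval; elim: n => [|n IHn]; first by rewrite big_geq.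
rewrite big_nat_recr // mkseqS bval_rcons size_mkseq PoszD IHn; congr (_ + _).
by rewrite PoszM mulrC; rewrite Posz_exp2.
Qed.

Lemma pval_bound (w : stream) (n : nat) : 0 <= pval w n < 2 ^+ n.
Proof.
rewrite /pval lez_nat leq0n /= -Posz_exp2 ltz_nat.
by rewrite -[n in (2 ^ n)%N](size_mkseq w n) bval_lt.
Qed.

Lemma pval_eq (v w : stream) (n : nat) :
  pval v n = pval w n -> mkseq v n = mkseq w n.
Proof. by case=> /bval_inj; rewrite !size_mkseq => ->. Qed.

(** A 2-adic integer is determined by its residues modulo all [2 ^+ n]; identities between streams
    thus reduce to congruences. *)
Lemma stream_eq (v w : stream) :
  (forall n, pval v n = pval w n %[mod 2 ^+ n])%Z -> v = w.
Proof.
move=> E; apply: functional_extensionality => i.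
have Ei := E i.+1; rewrite !modz_small ?pval_bound // in Ei.
by rewrite -(nth_mkseq false v (ltnSn i)) (pval_eq Ei) nth_mkseq.
Qed.

Lemma eqz_nat_pow (x y n : nat) :
  (x = y %[mod 2 ^ n])%N -> (x%:Z = y%:Z %[mod 2 ^+ n])%Z.
Proof.
by rewrite -Posz_exp2 !modz_nat => ->.
Qed.

Lemma pval_a (w : stream) (n : nat) :
  (pval (a_stream w) n = pval w n + 1 %[mod 2 ^+ n])%Z.
Proof.
rewrite -PoszD addn1; apply: eqz_nat_pow.
by rewrite mkseq_a -[in (2 ^ n)%N](size_mkseq w n) bval_a_word.
Qed.

Lemma pval_a_pow (m : int) (w : stream) (n : nat) :
  (pval (a_pow m w) n = pval w n + m %[mod 2 ^+ n])%Z.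
Proof.
have a_invP v : (pval (a_inv v) n = pval v n - 1 %[mod 2 ^+ n])%Z.
  apply/eqP; rewrite -(eqz_modDr 1) subrK; apply/eqP.
  by rewrite -pval_a a_invK.
case: m => k; first elim: k => [|k IHk]; rewrite /= ?addr0 //.
  by rewrite pval_a intS addrCA addrC -modzDml IHk modzDml.
rewrite NegzE; elim: k => [|k IHk] //=.
rewrite a_invP -modzDml IHk modzDml.
by congr (_ %% _)%Z; lia.
Qed.

Lemma pval_b (w : stream) (n k : nat) :
  w k -> (forall i, (i < k)%N -> w i = false) ->
  (pval (b_stream w) n = pval w n + 2 ^+ k.+1 %[mod 2 ^+ n])%Z.
Proof.
move=> wk w0; rewrite -(Posz_exp2 k.+1) -PoszD.
apply: eqz_nat_pow; rewrite mkseq_b -[X in (_ ^ X)%N](size_mkseq w n).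
by apply: bval_b_word; rewrite size_mkseq bval_mkseq_mod.
Qed.


(** * The orbit of a stream as a free a-orbit *)

Lemma a_powD (m k : int) (w : stream) : a_pow (m + k) w = a_pow m (a_pow k w).
Proof.
apply: stream_eq => n; rewrite !pval_a_pow -[in RHS]modzDml pval_a_pow modzDml.
by rewrite -addrA (addrC k).
Qed.

Lemma a_pow_inj (w : stream) : injective (a_pow^~ w).
Proof.
move=> m k E; apply/eqP; rewrite -subr_eq0.
(* Equal streams make [2 ^+ n] divide [m - k]; since [n < 2 ^ n], this choice forces [m = k]. *)
pose n := `|m - k|%N.
have : (pval w n + m == pval w n + k %[mod 2 ^+ n])%Z.
  by rewrite -!pval_a_pow E.
rewrite eqz_modDl eqz_mod_dvd.
rewrite dvdzE abszX => /dvdn_leq; rewrite absz_gt0.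
case: eqP => //= _ /(_ isT); rewrite leqNgt ltn_expl //.
Qed.

Lemma b_stream_first (w : stream) (k : nat) :
  w k -> (forall i, (i < k)%N -> w i = false) ->
  b_stream w = a_pow (2 ^+ k.+1) w.
Proof.
by move=> wk w0; apply: stream_eq => n; rewrite pval_a_pow (pval_b _ wk w0).
Qed.

Lemma b_stream_zero (w : stream) : (forall i, w i = false) -> b_stream w = w.
Proof.
move=> w0; apply: functional_extensionality => i.
elim: i w w0 => //= i IHi w w0; rewrite w0.
exact: (IHi (stail w) (fun j => w0 j.+1)).
Qed.

Lemma in_G_a_pow (m : int) : in_G (a_pow m).
Proof.
have Ga : in_G a_stream by apply: (in_G_gen gen_a).
have Gi : in_G a_inv by exact: in_G_inv Ga a_streamK a_invK.
case: m => k; last by elim: k => //= k IHk; apply: in_G_comp IHk.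
by elim: k => [|k IHk]; [apply: in_G_id | apply: in_G_comp IHk].
Qed.

(** The exponent depends on [w], because b translates by an amount read off [w]; the induction on
    [g] therefore runs over all [w] at once. *)
Lemma in_G_a_powP (g : stream -> stream) (w : stream) :
  in_G g -> exists m, g w = a_pow m w.
Proof.
move=> Gg; elim: Gg w => {g} [[]||g h _ IHg _ IHh|g h _ IHg gK hK] w.
- by exists 1.
- have [w0|[k [wk w0]]] := all_false_or_first w.
    by exists 0; apply: b_stream_zero.
  by exists (2 ^+ k.+1); apply: b_stream_first.
- by exists 0.
- have [m Em] := IHh w; have [k Ek] := IHg (h w).
  by exists (k + m); rewrite a_powD /= Ek Em.
(* The hypothesis at [h w] reads [w = g (h w) = a_pow m (h w)], to be solved for [h w]. *)
have [m Em] := IHg (h w); exists (- m).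
by rewrite -[in RHS](hK w) Em -a_powD addNr.
Qed.

Lemma orbit_a_pow (w : stream) (v : orbit_of w) :
  exists m, sval v = a_pow m w.
Proof. by case: v => v [g Gg Ev] /=; rewrite Ev; apply: in_G_a_powP. Qed.

Definition orbit_pow (w : stream) (m : int) : orbit_of w :=
  exist _ (a_pow m w) (ex_intro2 _ _ _ (in_G_a_pow m) (erefl _)).

(** The exponent chosen here is the only possible one, by [a_pow_inj]. *)
Definition orbit_coord (w : stream) (v : orbit_of w) : int :=
  sval (constructive_indefinite_description _ (orbit_a_pow v)).

Lemma orbit_coordK (w : stream) : cancel (@orbit_coord w) (@orbit_pow w).
Proof.
move=> v; apply: sig_inj; rewrite /orbit_coord.
by case: constructive_indefinite_description.
Qed.

Lemma orbit_powK (w : stream) : cancel (@orbit_pow w) (@orbit_coord w).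
Proof.
move=> m; apply: (@a_pow_inj w).
exact: (congr1 sval (orbit_coordK (orbit_pow w m))).
Qed.

(** * The edges of X_omega and the isomorphism of infinite graphs *)

(** The congruence for starting points becomes a pattern of letters: [2 ^+ n.+1] divides
    [m + a_coef w n.+1] iff the stream at [m] has value [2 ^+ n] modulo [2 ^+ n.+1], i.e. begins
    with 0...01. *)
Lemma E_orbitSP (w : stream) (n : nat) (e : int * int) :
  E_orbit w n.+1 e <->
  [/\ a_pow e.1 w n, forall i, (i < n)%N -> a_pow e.1 w i = false
    & e.2 = e.1 + 2 ^+ n.+1].
Proof.
have twoS : 2 ^+ n < 2 ^+ n.+1 :> int by rewrite ltr_eXn2l.
have first_val : (pval (a_pow e.1 w) n.+1 == 2 ^+ n %[mod 2 ^+ n.+1])%Z <->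
    a_pow e.1 w n /\ forall i, (i < n)%N -> a_pow e.1 w i = false.
  rewrite -bval_mkseq_first !modz_small ?pval_bound ?exprn_ge0 //.
  rewrite /pval -Posz_exp2; split=> [/eqP[]|->] //.
have start_val : (pval (a_pow e.1 w) n.+1 == 2 ^+ n %[mod 2 ^+ n.+1])%Z =
    (2 ^+ n.+1 %| e.1 + a_coef w n.+1)%Z.
  by rewrite pval_a_pow eqz_mod_dvd /a_coef -pvalE /=; congr (_ %| _)%Z; ring.
split=> [[z Ee]|[an a0 Ee]].
  suff [] : a_pow e.1 w n /\ forall i, (i < n)%N -> a_pow e.1 w i = false.
    by split=> //; rewrite Ee /=; ring.
  apply/first_val; rewrite start_val Ee /= subrK; exact: dvdz_mulr.
have : (2 ^+ n.+1 %| e.1 + a_coef w n.+1)%Z.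
  by rewrite -start_val; apply/first_val.
case/dvdzP=> z Ez; exists z; rewrite [e]surjective_pairing Ee.
by congr (_, _); rewrite mulrC ?mulrDl ?mul1r -?Ez; ring.
Qed.

Definition orbit_edge_inv (w : stream) (e : edge (X_orbit w)) :
    edge (Gamma_orbit w) :=
  match e with
  | inl c => (orbit_pow w (sval (tagged c)).1,
              if tag c is 0 then gen_a else gen_b)
  | inr v => (orbit_pow w (sval v), gen_b)
  end.

Lemma isolatedP (w : stream) (m : int) :
  isolated w m <-> forall i, a_pow m w i = false.
Proof.
split=> [iso i|a0 [//|n] e _ Ee].
  have [//|[n [an a0]]] := all_false_or_first (a_pow m w).
  have /iso : (0 < n.+1)%N by [].
  by case/(_ (m, m + 2 ^+ n.+1)); [apply/E_orbitSP | case].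
(* The end of an edge starts the next edge of its level, so it too has a letter 1. *)
have e2 : E_orbit w n.+1 (e.2, e.2 + 2 ^+ n.+1).
  by case: Ee => z ->; exists (z + 1); congr (_, _) => /=; ring.
split=> Em; first by case/E_orbitSP: Ee; rewrite -Em a0.
by case/E_orbitSP: e2; rewrite -Em a0.
Qed.

Lemma E_orbit_inj (w : stream) (n : nat) (e e' : int * int) :
  E_orbit w n e -> E_orbit w n e' -> e.1 = e'.1 -> e = e'.
Proof.
case: n => [[z ->] [z' ->] /= -> //|n].
move=> /E_orbitSP[_ _ e2] /E_orbitSP[_ _ e'2] E1.
by rewrite [e]surjective_pairing [e']surjective_pairing e2 e'2 E1.
Qed.

Lemma orbit_edge_inv_bij (w : stream) : bijective (@orbit_edge_inv w).
Proof.
apply: inj_surj_bij.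
  move=> [[n [e Ee]]|[v iso]] [[n' [e' Ee']]|[v' iso']] //= [].
  - move=> Ev Eg; have {}Ev := a_pow_inj Ev.
    suff En : n = n'.
      subst n'; congr (inl (existT _ n _)); apply: sig_inj.
      exact: (E_orbit_inj Ee Ee' Ev).
    (* The generator separates level 0 from the others; a positive level is read off the position of
       the first letter 1. *)
    case: n n' Ee Ee' Eg => [|n] [|n'] // /E_orbitSP[an a0 _] /E_orbitSP[].
    rewrite -Ev => an' a0' _ _; congr S.
    case: (ltngtP n n') => // lt; first by rewrite a0' in an.
    by rewrite a0 in an'.
  - case: n Ee => // n Ee /a_pow_inj E.
    by case: (iso' n.+1 e isT Ee) => /(_ (esym E)).
  - case: n' Ee' => // n Ee' /a_pow_inj E.
    by case: (iso n.+1 e' isT Ee') => /(_ E).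
  - by move=> /a_pow_inj E; congr inr; apply: sig_inj.
move=> [v s]; rewrite -(orbit_coordK v); move: (orbit_coord v) => m.
case: s.
  have E0 : E_orbit w 0 (m, m + 1) by exists m.
  by exists (inl (existT _ 0%N (exist _ _ E0))).
(* A b-edge comes from the added loop at the zero stream, and otherwise from the level given by the
   first letter 1. *)
have [a0|[n [an a0]]] := all_false_or_first (a_pow m w).
  have /isolatedP iso := a0.
  by exists (inr (exist _ _ iso)).
have En : E_orbit w n.+1 (m, m + 2 ^+ n.+1) by apply/E_orbitSP.
by exists (inl (existT _ n.+1 (exist _ _ En))).
Qed.

Lemma orbit_coord_unique (w : stream) :
  unique (rule_orbit w) (@orbit_coord w).
Proof.
split=> [m v Ev|phi rule_phi].
  by apply: (@a_pow_inj w); rewrite -Ev -[in RHS](orbit_coordK v).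
apply: functional_extensionality => v; apply/esym/rule_phi.
by rewrite -[in LHS](orbit_coordK v).
Qed.

Lemma orbit_coord_iso (w : stream) :
  graph_iso (Gamma_orbit w) (X_orbit w) (@orbit_coord w).
Proof.
apply: graph_iso_inv (@orbit_edge_inv_bij w) _.
  by exists (@orbit_pow w); [apply: orbit_coordK | apply: orbit_powK].
have act_pow s m k : act_stream s (a_pow m w) = a_pow k w ->
    orbit_coord (act_orbit s (orbit_pow w m)) = k.
  by move=> E; apply: (canLR (@orbit_powK w)); apply: sig_inj.
case=> [[n [e Ee]]|[m iso]] /=; rewrite orbit_powK; last first.
  by rewrite (@act_pow _ _ m) //=; apply/b_stream_zero/isolatedP.
rewrite [LHS]surjective_pairing; congr (_, _); apply/esym/act_pow.
case: n Ee => [[z ->]|n /E_orbitSP[an a0 ->]] /=; first by rewrite addrC a_powD.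
by rewrite (b_stream_first an a0) addrC a_powD.
Qed.

(** * The isomorphism of finite graphs *)

Definition word_coord (n : nat) (t : n.-tuple bool) : 'Z_(2 ^ n) := (bval t)%:R.

Lemma Zp_nat_eq (N x y : nat) :
  (1 < N)%N -> x%:R = y%:R :> 'Z_N <-> (x = y %[mod N])%N.
Proof.
move=> N_gt1; rewrite -!(val_Zp_nat N_gt1).
by split=> [->|/val_inj].
Qed.

Lemma exp2_gt1 (n : nat) : (0 < n)%N -> (1 < 2 ^ n)%N.
Proof. by move=> n_gt0; rewrite -[1%N](expn0 2) ltn_exp2l. Qed.

Lemma word_coord_bij (n : nat) (n_gt0 : (0 < n)%N) : bijective (@word_coord n).
Proof.
apply: inj_card_bij => [s t /Zp_nat_eq|].
  move=> /(_ (exp2_gt1 n_gt0)) E.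
  by apply/val_inj/bval_inj_mod; rewrite !size_tuple.
by rewrite card_tuple card_bool card_ord Zp_cast ?exp2_gt1.
Qed.

Lemma word_coord_a (n : nat) (n_gt0 : (0 < n)%N) (t : n.-tuple bool) :
  word_coord (act_tuple gen_a t) = word_coord t + 1.
Proof.
rewrite /word_coord natr1; apply/(Zp_nat_eq _ _ (exp2_gt1 n_gt0)) => /=.
by rewrite -[X in (_ ^ X)%N](size_tuple t) bval_a_word.
Qed.

Lemma word_coord_b (n : nat) (n_gt0 : (0 < n)%N) (t : n.-tuple bool)
    (k z : nat) :
  word_coord t = (2 ^ k.+1 * z + 2 ^ k)%:R ->
  word_coord (act_tuple gen_b t) = word_coord t + (2 ^ k.+1)%:R.
Proof.
move=> /Zp_nat_eq => /(_ (exp2_gt1 n_gt0)) E.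
rewrite /word_coord -natrD; apply/(Zp_nat_eq _ _ (exp2_gt1 n_gt0)) => /=.
rewrite -[X in (_ ^ X)%N](size_tuple t); apply: bval_b_word; rewrite size_tuple.
(* Passing to the modulus [2 ^ minn k.+1 n] kills [2 ^ k.+1 * z], also when [k >= n]. *)
have dvd_n : (2 ^ minn k.+1 n %| 2 ^ n)%N by rewrite dvdn_exp2l ?geq_minr.
have dvd_k : (2 ^ minn k.+1 n %| 2 ^ k.+1)%N by rewrite dvdn_exp2l ?geq_minl.
rewrite -[LHS](modn_dvdm _ dvd_n) E modn_dvdm // -modnDml.
by rewrite (eqP (dvdn_mulr z dvd_k)) add0n.
Qed.

Lemma word_coord_iter (n : nat) (n_gt0 : (0 < n)%N) (m : nat) :
  word_coord (iter m (act_tuple gen_a) (nseq_tuple n false)) = m%:R.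
Proof.
elim: m => [|m IHm]; first by rewrite /word_coord /= bval_nseq0.
by rewrite iterS word_coord_a // IHm natr1.
Qed.

Lemma word_coord_unique (n : nat) (n_gt0 : (0 < n)%N) :
  unique (rule_fin n) (@word_coord n).
Proof.
split=> [m lt_m|phi rule_phi]; first
  by rewrite word_coord_iter // val_Zp_nat ?exp2_gt1 // modn_small.
apply: functional_extensionality => t; apply: val_inj => /=.
have lt_t : (bval t < 2 ^ n)%N.
  by rewrite -[X in (_ ^ X)%N](size_tuple t) bval_lt.
have {2}-> : t = iter (bval t) (act_tuple gen_a) (nseq_tuple n false).
  by apply: (bij_inj (word_coord_bij n_gt0)); rewrite word_coord_iter.
by rewrite rule_phi // val_Zp_nat ?exp2_gt1 // modn_small.
Qed.

Lemma E_fin1P (n : nat) (e : 'Z_(2 ^ n) * 'Z_(2 ^ n)) :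
  E_fin1 e <-> e.2 = e.1 + 1.
Proof.
split=> [[z ->]|E]; first by rewrite /= rmorphD.
exists (e.1 : nat)%:Z; rewrite [LHS]surjective_pairing E rmorphD /=.
by rewrite -[_%:~R]/(_%:R) natr_Zp.
Qed.

(** Every residue starts an edge of the second kind: [k] is the 2-adic valuation of the value, and
    [z] comes from its odd part. *)
Lemma word_start (n : nat) (n_gt0 : (0 < n)%N) (t : n.-tuple bool) :
  exists k z, word_coord t = (2 ^ k.+1 * z + 2 ^ k)%:R.
Proof.
have [t0|t_gt0] := posnP (bval t).
  (* Zero is reached with [k = n], since [2 ^ n] vanishes in the quotient. *)
  exists n, 0%N; rewrite muln0 /word_coord t0.
  apply/(Zp_nat_eq _ _ (exp2_gt1 n_gt0)).
  by rewrite modnn mod0n.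
have [d odd_d Et] := pfactor_coprime (isT : prime 2) t_gt0.
rewrite coprime2n in odd_d; exists (logn 2 (bval t)), d./2.
rewrite /word_coord {1}Et; congr _%:R.
by rewrite -{1}(odd_double_half d) odd_d -mul2n expnS mulnDl mul1n addnC mulnAC.
Qed.

(** A residue may be presented by several [k] and [z], but [word_coord_b] shows that each yields the
    b-image as end; [word_start] supplies one presentation. *)
Lemma E_fin2P (n : nat) (n_gt0 : (0 < n)%N)
    (e : 'Z_(2 ^ n) * 'Z_(2 ^ n)) (t : n.-tuple bool) :
  e.1 = word_coord t ->
  E_fin2 e <-> e.2 = word_coord (act_tuple gen_b t).
Proof.
have castE (k z : nat) : (2 ^+ k.+1 * z%:Z + 2 ^+ k)%:~R =
    (2 ^ k.+1 * z + 2 ^ k)%:R :> 'Z_(2 ^ n).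
  by rewrite -!Posz_exp2 -PoszM -PoszD.
move=> E1; split=> [[z [[|k] [//= _ Ee]]]|E2].
  (* A negative [z] is replaced by a natural representative of its residue. *)
  have [y Ez] : exists y : nat, z%:~R = y%:~R :> 'Z_(2 ^ n).
    by exists (z%:~R : 'Z_(2 ^ n)); rewrite -[RHS]/(_%:R) natr_Zp.
  have Et : word_coord t = (2 ^ k.+1 * y + 2 ^ k)%:R.
    by rewrite -E1 Ee -castE /= !intrD !intrM Ez.
  rewrite (word_coord_b n_gt0 Et) -E1 Ee /= -[(2 ^ k.+1)%:R]/(_%:Z%:~R) Posz_exp2.
  by rewrite -rmorphD; congr (_%:~R); ring.
have [k [z Et]] := word_start n_gt0 t.
exists z%:Z, k.+1; split=> //; rewrite [LHS]surjective_pairing E2 E1.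
rewrite (word_coord_b n_gt0 Et) Et -castE -[(2 ^ k.+1)%:R]/(_%:Z%:~R) Posz_exp2.
by rewrite -rmorphD; congr (_, _%:~R); ring.
Qed.

Lemma word_coord_iso (n : nat) :
  (0 < n)%N -> graph_iso (Gamma_fin n) (X_fin n) (@word_coord n).
Proof.
move=> n_gt0; have phi_bij := word_coord_bij n_gt0.
have [psi phiK psiK] := phi_bij.
pose h (e : edge (X_fin n)) : edge (Gamma_fin n) :=
  match e with
  | inl c => (psi (sval c).1, gen_a)
  | inr c => (psi (sval c).1, gen_b)
  end.
have ends_h e : ends e = (word_coord (ends (h e)).1, word_coord (ends (h e)).2).
  case: e => [[e Ee]|[e Ee]] /=; rewrite psiK [LHS]surjective_pairing.
    by rewrite word_coord_a // psiK; congr (_, _); apply/E_fin1P.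
  by congr (_, _); apply/E_fin2P; rewrite ?psiK.
apply: graph_iso_inv (ends_h) => //.
apply: inj_surj_bij => [e e' Eh|[t s]].
  (* Edges with the same image have the same ordered ends, which determine an edge within its kind;
     the generator tells the kind. *)
  have := ends_h e; rewrite Eh -ends_h => {ends_h} Ee.
  by case: e e' Eh Ee => c [] c' //= _ /sig_inj ->.
case: s.
  have E1 : E_fin1 (word_coord t, word_coord t + 1) by apply/E_fin1P.
  by exists (inl (exist _ _ E1)); rewrite /= phiK.
have E2 : E_fin2 (word_coord t, word_coord (act_tuple gen_b t)).
  by apply/(E_fin2P n_gt0 (t := t)).
by exists (inr (exist _ _ E2)); rewrite /= phiK.
Qed.

Theorem theorem9 :
  (forall w : stream,
     exists phi : vertex (Gamma_orbit w) -> vertex (X_orbit w),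
       unique (rule_orbit w) phi /\ graph_iso (Gamma_orbit w) (X_orbit w) phi)
  /\
  (forall n : nat, (1 <= n)%N ->
     exists phi : vertex (Gamma_fin n) -> vertex (X_fin n),
       unique (rule_fin n) phi /\ graph_iso (Gamma_fin n) (X_fin n) phi).
Proof.
split=> [w|n n_gt0].
  exists (@orbit_coord w).
  by split; [apply: orbit_coord_unique | apply: orbit_coord_iso].
exists (@word_coord n).
by split; [apply: word_coord_unique | apply: word_coord_iso].
Qed.
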